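(* Let $\varphi:\mathbb{R}\to\mathbb{R}$ be locally Lipschitz continuous, let $\varrho\in\mathbb{R}$ and let $\lambda^*$ be a solution to $\varphi(\lambda)=\varrho$. Assume that the Clarke generalized Jacobian $\partial\varphi(\lambda^* )$ is a singleton $\{v^*\}$ with $v^*\neq0$. Let $\{\lambda^k\}_{k\ge-1}$ be the sequence generated by the secant method $$\lambda^{k+1}=\lambda^k-\left(\delta_\varphi(\lambda^k,\lambda^{k-1})\right)^{-1}\left(\varphi(\lambda^k)-\varrho\right),\qquad k=0,1,2,\dots,$$ from initial points $\lambda^{-1},\lambda^0$ sufficiently close to $\lambda^*$. Denote $e_k:=\lambda^k-\lambda^*$ and assume $|e_k|>0$ for all $k\ge-1$. Then: (i) If $\varphi$ is semismooth at $\lambda^*$, the sequence $\{\lambda^k\}$ converges to $\lambda^*$ Q-superlinearly. (ii) Suppose that $\varphi$ is $\gamma$-order semismooth at $\lambda^*$ for some $\gamma>0$. Denote $c_k:=|e_k|/(|e_{k-1}||e_{k-2}|^\gamma)$ for $k\geq1$. Then either one of the following two properties is satisfied: (1) $\{\lambda^k\}$ converges to $\lambda^*$ superlinearly with Q-order at least $(1+\sqrt{1+4\gamma})/2$; (2) $\{\lambda^k\}$ converges to $\lambda^*$ superlinearly with R-order at least $(1+\sqrt{1+4\gamma})/2$, and for any constant $\underline{C}>0$ there exists a subsequence $\{c_{i_k}\}$ satisfying $c_{i_k}<\underline{C}\,i_k^{-i_k}$.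
   Context: For distinct $x,y\in\mathbb{R}$, $\delta_f(x,y):=\frac{f(x)-f(y)}{x-y}$ is the divided difference. ''Sufficiently close'' means: there is a neighborhood $\mathcal{U}$ of $\lambda^*$ (depending on $\varphi$) such that the conclusions hold for all $\lambda^{-1},\lambda^0\in\mathcal{U}$, $\lambda^{-1}\ne\lambda^0$, subject to the stated assumption $|e_k|>0$. For a locally Lipschitz function $F$ on an open set, $\partial_BF(x)$ is the set of limits of derivatives $F'(x^k)$ along sequences $x^k\to x$ of differentiability points, and $\partial F(x):=\operatorname{conv}\partial_BF(x)$ is the Clarke generalized Jacobian. $F$ is G-semismooth (resp. $\gamma$-order G-semismooth) at $x$ if for any $h\to0$ and $V\in\partial F(x+h)$, $F(x+h)-F(x)-Vh=o(\|h\|)$ (resp. $O(\|h\|^{1+\gamma})$). $F$ is directionally differentiable at $x$ if $F'(x;h):=\lim_{t\downarrow0}(F(x+th)-F(x))/t$ exists for all $h$, and $\gamma$-order directionally differentiable if in addition $F(x+h)-F(x)-F'(x;h)=O(\|h\|^{1+\gamma})$ as $h\to0$. $F$ is semismooth at $x$ if it is G-semismooth and directionally differentiable there, and $\gamma$-order semismooth if it is $\gamma$-order G-semismooth and $\gamma$-order directionally differentiable there. Q-superlinear convergence means $|e_{k+1}|=o(|e_k|)$. Orders are in the usual (Ortega–Rheinboldt) sense: Q-order at least $t>1$ means $\limsup_k|e_{k+1}|/|e_k|^{s}<\infty$ for every $s\in[1,t)$; R-order at least $t>1$ means $\limsup_k|e_k|^{1/s^k}<1$ for every $s\in(1,t)$.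 *)

(* Defs.v *)
(* MathComp-Analysis, over an arbitrary R : realType *)
From HB Require Import structures.
From mathcomp Require Import all_boot all_order all_algebra.
From mathcomp Require Import all_classical all_reals all_analysis.

Set Implicit Arguments.
Unset Strict Implicit.
Unset Printing Implicit Defensive.

Import Order.TTheory GRing.Theory Num.Theory.
Import numFieldNormedType.Exports.

Local Open Scope classical_set_scope.
Local Open Scope ring_scope.

Definition locally_lipschitz (R : realType) (F : R -> R) : Prop :=
  forall x : R, exists2 U, nbhs x U & [lipschitz F y | y in U].

Definition divided_difference (R : realType) (f : R -> R) (x y : R) : R :=
  (f x - f y) / (x - y).

Definition B_subdifferential (R : realType) (F : R -> R) (x : R) : set R :=
  [set v | exists u : nat -> R,
    [/\ forall k, derivable F (u k) 1,
        u @ \oo --> x &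
        (fun k => derive1 F (u k)) @ \oo --> v]].

(* The convex hull is taken as the smallest convex superset; R^o is R seen as
   a module over itself. *)
Definition clarke_jacobian (R : realType) (F : R -> R) (x : R) : set R :=
  smallest (@convex_set R R^o) (B_subdifferential F x).

(* The bounds below are uniform in V, and h = 0 is allowed: then x + h = x and
   both sides vanish. *)
Definition G_semismooth (R : realType) (F : R -> R) (x : R) : Prop :=
  forall eps : R, 0 < eps ->
    \forall h \near (0 : R), forall V : R, clarke_jacobian F (x + h) V ->
      `|F (x + h) - F x - V * h| <= eps * `|h|.

Definition order_G_semismooth (R : realType) (gamma : R) (F : R -> R) (x : R)
    : Prop :=
  exists C : R,
    \forall h \near (0 : R), forall V : R, clarke_jacobian F (x + h) V ->
      `|F (x + h) - F x - V * h| <= C * `|h| `^ (1 + gamma).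

Definition dir_quotient (R : realType) (F : R -> R) (x h : R) : R -> R :=
  fun t => (F (x + t * h) - F x) / t.

Definition dir_differentiable (R : realType) (F : R -> R) (x : R) : Prop :=
  forall h : R, cvg (dir_quotient F x h @ 0^'+).

Definition dir_derivative (R : realType) (F : R -> R) (x h : R) : R :=
  lim (dir_quotient F x h @ 0^'+).

Definition order_dir_differentiable (R : realType) (gamma : R) (F : R -> R)
    (x : R) : Prop :=
  dir_differentiable F x /\
  exists C : R,
    \forall h \near (0 : R),
      `|F (x + h) - F x - dir_derivative F x h| <= C * `|h| `^ (1 + gamma).

Definition semismooth (R : realType) (F : R -> R) (x : R) : Prop :=
  G_semismooth F x /\ dir_differentiable F x.

Definition order_semismooth (R : realType) (gamma : R) (F : R -> R) (x : R)
    : Prop :=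
  order_G_semismooth gamma F x /\ order_dir_differentiable gamma F x.

(* Only the values lam k with -1 <= k matter. No nondegeneracy is assumed of
   the steps: as x / 0 = 0, a step with lam k = lam (k - 1) or with a zero
   divided difference reads lam (k + 1) = lam k. *)
Definition secant_sequence (R : realType) (phi : R -> R) (rho : R)
    (lam : int -> R) : Prop :=
  forall k : int, 0 <= k ->
    lam (k + 1) =
    lam k - (divided_difference phi (lam k) (lam (k - 1)))^-1
            * (phi (lam k) - rho).

Definition q_superlinear (R : realType) (u : nat -> R) (l : R) : Prop :=
  u @ \oo --> l /\
  (fun k => `|u k.+1 - l|) =o_\oo (fun k => `|u k - l|).

Definition q_order_at_least (R : realType) (t : R) (u : nat -> R) (l : R)
    : Prop :=
  forall s : R, 1 <= s -> s < t ->
    (limn_esup (fun k => (`|u k.+1 - l| / `|u k - l| `^ s)%:E) < +oo)%E.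

Definition r_order_at_least (R : realType) (t : R) (u : nat -> R) (l : R)
    : Prop :=
  forall s : R, 1 < s -> s < t ->
    (limn_esup (fun k => (`|u k - l| `^ (1 / s ^+ k))%:E) < 1)%E.

(* Main.v *)
Require Import Defs.
From HB Require Import structures.
From mathcomp Require Import all_boot all_order all_algebra.
From mathcomp Require Import all_classical all_reals all_analysis.
From mathcomp Require Import ring lra.

Import Order.TTheory GRing.Theory Num.Theory.
Import numFieldNormedType.Exports.

Local Open Scope classical_set_scope.
Local Open Scope ring_scope.

(* Rademacher's theorem on the line turns the singleton Clarke Jacobian into
   strict differentiability of phi at lstar: a Lipschitz function plus a
   multiple of the identity is nondecreasing, its Stieltjes measure is dominated
   by Lebesgue measure, and its increments are integrals of the derivative, so
   bounds on the derivative where it exists bound the slopes. Near lstar the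
   divided differences are then close to vstar, each secant step at least halves
   the error, and convergence is superlinear.

   Put u_n = - ln |e_n|. The order-gamma expansion of phi at lstar gives
   u_{n+2} >= u_{n+1} + gamma u_n - const, hence u_n >= m t^n where
   t^2 = t + gamma: this is the R-order. If moreover c_n >= C n^-n eventually,
   the reverse inequality holds up to O(n^2), so u_{n+1} - t u_n solves a
   first-order recursion of ratio -(t - 1), grows slower than t^n, and u_n
   dominates it: this is the Q-order. *)

(** * Slope bounds for Lipschitz functions from bounds on the derivative *)

(** Both measures are infima over countable covers by half-open intervals, so comparing them on each
    interval of a cover is enough. *)
Lemma lebesgue_stieltjes_le_lebesgue (R : realType) (g : cumulative R R) (K : R)
    (A : set R) : 0 < K ->
  (forall x y, x <= y -> g y - g x <= K * (y - x)) ->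
  (lebesgue_stieltjes_measure g A <= K%:E * lebesgue_measure A)%E.
Proof.
move=> K0 gK; rewrite -lee_pdivrMl// /lebesgue_measure.
apply: le_ereal_inf_tmp => _ [F [mF AF] <-].
rewrite lee_pdivrMl// -nneseriesZl//.
apply: (@le_trans _ _ (\sum_(k <oo) wlength g (F k))%E).
  by apply: ereal_inf_lbound; exists F.
apply: lee_nneseries => [i ? ?|i ?]; first exact: wlength_ge0.
suff : (wlength g (F i) <= K%:E * wlength idfun (F i))%E by [].
have /ocitvP[->|[[x y]/= xy ->]] := mF i; first by rewrite !wlength0 mule0.
by rewrite !wlength_itv_bnd ?(ltW xy)// -EFinM lee_fin; exact/gK/ltW.
Qed.

(** By Lebesgue differentiation, the density of the Stieltjes measure is almost everywhere the
    derivative of [g], hence at most [M] inside the interval; its integral is the increment. *)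
Lemma lipschitz_cumulative_slope_le (R : realType) (g : cumulative R R)
    (K M a b : R) : 0 < K ->
  (forall x y, x <= y -> g y - g x <= K * (y - x)) ->
  a < b -> 0 <= M ->
  (forall x, a < x < b -> derivable (g : R -> R) x 1 ->
    derive1 (g : R -> R) x <= M) ->
  g b - g a <= M * (b - a).
Proof.
move=> K0 gK ab M0 gM.
pose mu := @lebesgue_measure R.
have lsE x : a <= x -> x <= b ->
    lebesgue_stieltjes_measure g `]a, x]%classic = (g x - g a)%:E.
  move=> ax xb.
  rewrite /lebesgue_stieltjes_measure /measure_extension measurable_mu_extE/=;
    last exact: is_ocitv.
  by rewrite wlength_itv_bnd.
have mab : measurable (`]a, b]%classic : set (measurableTypeR R)).
  exact: measurable_itv.
have fin : (lebesgue_stieltjes_measure g `]a, b]%classic < +oo)%E.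
  by rewrite lsE ?ltry// ltW.
(* Restriction to the interval makes the measure finite, so Radon-Nikodym applies. *)
pose nu : {finite_measure set (measurableTypeR R) -> \bar R} := mfrestr mab fin.
have numu : nu `<< mu.
  apply/null_content_dominatesP => A mA muA0.
  apply/eqP; rewrite eq_le measure_ge0 andbT /nu/= /mfrestr /mrestr.
  apply: le_trans (lebesgue_stieltjes_le_lebesgue _ _ _ _ K0 gK) _.
  rewrite -[leRHS](mule0 K%:E) lee_pmul2l// -muA0.
  by apply: le_outer_measure; exact: subIsetl.
have [h [h0 hfin hint hE]] := radon_nikodym_sigma_finite numu.
pose h' := fine \o h.
have hh' : h = EFin \o h' by apply/funext => x /=; rewrite fineK.
have h'int : mu.-integrable setT (EFin \o h') by rewrite -hh'.
have intS (A : set R) : measurable A -> mu.-integrable A (EFin \o h').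
  by move=> mA; exact: integrableS h'int.
have lint : locally_integrable setT h'.
  by apply: open_integrable_locally => //; exact: openT.
have /= dF := FTC1 (a := BRight a) (fun y => intS _ (measurable_itv _)) lint.
have FE x : a <= x -> x <= b ->
    (\int[mu]_(t in [set` Interval (BRight a) (BRight x)]) h' t = g x - g a)%R.
  move=> ax xb; rewrite /Rintegral.
  transitivity (fine (nu `]a, x]%classic)).
    by rewrite hE// hh'.
  rewrite /nu/= /mfrestr /mrestr setIidl ?lsE//.
  by apply: subset_itvl; rewrite bnd_simp.
have hM : {ae mu, forall x, `]a, b[%classic x -> ((h' x)%:E <= M%:E)%E}.
  apply: (@filterS _ _ (ae_filter_ringOfSetsType mu) _ _ _ dF) => x /= {}dF.
  rewrite in_itv/= => /andP[ax xb]; rewrite lee_fin.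
  set F := (fun y => _) in dF; have [dFx dFE] := dF ax.
  have {dFE}dFx : is_derive x 1 F (h' x) by apply: DeriveDef dFx _; rewrite -derive1E.
  (* Near [x], [g] is the primitive of the density plus the constant [g a], so differentiability
     passes from the primitive to [g]. *)
  have dgx : is_derive x 1 (g : R -> R) (h' x).
    apply: (@near_eq_is_derive _ _ _ (F + cst (g a)%R)); last first.
      by apply: is_derive_eq; rewrite addr0.
    near=> y; rewrite /= /F fctE FE ?subrK//.
      by apply/ltW; near: y; exact: lt_nbhsr.
    by apply/ltW; near: y; exact: lt_nbhsl.
  have <- : derive1 (g : R -> R) x = h' x by rewrite derive1E derive_val.
  by apply: gM; [rewrite ax|exact: ex_derive].
rewrite -lee_fin -lsE ?(ltW ab)//.
have -> : lebesgue_stieltjes_measure g `]a, b]%classic = nu `]a, b]%classic.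
  by rewrite /nu/= /mfrestr /mrestr setIid.
rewrite hE// hh' -integral_itv_bndo_bndc; last first.
  exact: (measurable_int mu (intS _ (measurable_itv _))).
apply: (@le_trans _ _ (\int[mu]_(x in `]a, b[%classic) (cst M%:E x))%E).
  apply: ae_ge0_le_integral hM => //.
  - by move=> x _; rewrite lee_fin fine_ge0.
  - exact: (measurable_int mu (intS _ (measurable_itv _))).
rewrite integral_cst//= lebesgue_measure_itv/= lte_fin ab.
by rewrite -EFinB -EFinM.
Unshelve. all: by end_near. Qed.

Lemma lipschitz_slope_le (R : realType) (f : R -> R) (K M a b : R) : a < b ->
  (forall x y, a <= x <= b -> a <= y <= b -> `|f x - f y| <= K * `|x - y|) ->
  (forall x, a < x < b -> derivable f x 1 -> derive1 f x <= M) ->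
  f b - f a <= M * (b - a).
Proof.
move=> ab fK fM.
(* [k >= K] will make [f + k * id] nondecreasing on [a, b], and [k >= - M] makes the bound [M + k]
   nonnegative. *)
pose k := `|K| + `|M| + 1.
have [K0 M0] : 0 <= `|K| /\ 0 <= `|M| by [].
have kK : K <= k by have := ler_norm K; rewrite /k; lra.
have kM : - k <= M by have := ler_norm (- M); rewrite normrN /k; lra.
have k0 : 0 < k by rewrite /k; lra.
(* Clamping to [a, b] makes f globally Lipschitz; adding k * id makes it
   nondecreasing. *)
pose c x : R := Num.max a (Num.min x b).
have cab x : a <= c x <= b.
  by rewrite le_max lexx/= ge_max (ltW ab)/= ge_min lexx orbT.
have cE x : a <= x <= b -> c x = x.
  by move=> /andP[ax xb]; rewrite /c min_l// max_r.
have cnd x y : x <= y -> 0 <= c y - c x <= y - x.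
  rewrite /c /Num.max /Num.min => xy.
  by do ![case: ifPn]; rewrite -?leNgt; lra.
pose g x : R := f (c x) + k * c x.
have gxy x y : x <= y -> 0 <= g y - g x <= (k + k) * (y - x).
  move=> xy; have /andP[c0 cxy] := cnd _ _ xy.
  have := fK _ _ (cab y) (cab x); rewrite ler_norml (ger0_norm c0) /g => /andP[].
  by nra.
have gc : continuous g.
  move=> x; apply/cvgrPdist_le => e e0; near=> y.
  have d : `|x - y| <= e / (k + k).
    near: y; apply: (@cvgr_dist_le _ _ _ _ _ id) => //.
    by rewrite divr_gt0// addr_gt0.
  rewrite (@le_trans _ _ ((k + k) * `|x - y|))//; last first.
    by rewrite mulrC -ler_pdivlMr// addr_gt0.
  have [xy|/ltW yx] := leP x y.
    have /andP[g0 g1] := gxy _ _ xy.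
    by rewrite distrC ger0_norm// (distrC x) ger0_norm// subr_ge0.
  by have /andP[g0 g1] := gxy _ _ yx; rewrite !ger0_norm// subr_ge0.
have gnd : nondecreasing g.
  by move=> x y /gxy /andP[+ _]; rewrite subr_ge0.
pose gi := isCumulative.Build R _ R g gnd (right_continuousW gc).
pose G : cumulative R R := HB.pack g gi.
have := lipschitz_cumulative_slope_le _ G (k + k) (M + k) a b.
rewrite /= /g !cE ?lexx ?(ltW ab)//.
suff H : forall x, a < x < b -> derivable g x 1 -> derive1 g x <= M + k.
  have : 0 < k + k by lra.
  move=> k2 /(_ k2 _ ab _ H) => {}H.
  have := H (fun x y xy => proj2 (andP (gxy x y xy))).
  by lra.
move=> x /[dup] axb /andP[ax xb] dg.
have dgx : is_derive x 1 g (derive1 g x).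
  by apply: DeriveDef dg _; rewrite derive1E.
(* The clamp is the identity near [x], so there [f] is [g - k * id]. *)
have dfx : is_derive x 1 f (derive1 g x - k).
  apply: (@near_eq_is_derive _ _ _ (g - k *: id)); last first.
    by apply: is_derive_eq; rewrite /GRing.scale/= mulr1.
  near=> y.
  have /cE cy : a <= y <= b.
    by apply/andP; split; apply/ltW; near: y; [exact: lt_nbhsr|exact: lt_nbhsl].
  by rewrite !fctE /= /g cy /GRing.scale/= addrK.
have := fM x axb (@ex_derive _ _ _ _ _ _ _ dfx).
by rewrite derive1E (@derive_val _ _ _ _ _ _ _ dfx) lerBlDr.
Unshelve. all: by end_near. Qed.

(** * From a singleton Clarke Jacobian to strict differentiability *)

Lemma derive1_lipschitz_le (R : realType) (f : R -> R) (K x : R) :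
  (\forall y \near x, `|f y - f x| <= K * `|y - x|) ->
  derivable f x 1 -> `|derive1 f x| <= K.
Proof.
move=> /nbhs_ballP[d /= d0 fK] dfx; rewrite derive1E.
apply: (cvgr_to_le (cvg_norm dfx)).
near=> h.
have h0 : 0 < `|h|.
  by rewrite normr_gt0; near: h; exact: nbhs_dnbhs_neq.
rewrite /= /GRing.scale/= mulr1 normrM normfV ler_pdivrMl// mulrC.
rewrite -[in leRHS](addrK x h); apply: fK.
rewrite /ball/= opprD addrCA subrr addr0 normrN.
by near: h; exact: dnbhs0_lt.
Unshelve. all: by end_near. Qed.

Lemma locally_lipschitz_ball (R : realType) (f : R -> R) (x : R) :
  locally_lipschitz f -> exists K, exists2 d, 0 < d &
    forall y z, ball x d y -> ball x d z -> `|f y - f z| <= K * `|y - z|.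
Proof.
move=> /(_ x)[U /nbhs_ballP[d /= d0 dU] [M [Mreal fM]]].
(* The Lipschitz predicate speaks of all constants above some [M], whence [M + 1]. *)
exists (M + 1), d => // y z /dU Uy /dU Uz.
have := fM (M + 1); rewrite ltrDl ltr01 => /(_ isT) /(_ (y, z)); apply.
by split.
Qed.

(** Otherwise differentiability points tend to [x] with derivatives more than [eps] away from [v]. A
    local Lipschitz constant bounds these, so a subsequence converges to an element of the
    B-subdifferential other than [v]. *)
Lemma B_subdifferential_singleton_near (R : realType) (f : R -> R) (x v : R) :
  locally_lipschitz f -> B_subdifferential f x `<=` [set v] ->
  forall eps, 0 < eps ->
    \forall y \near x, derivable f y 1 -> `|derive1 f y - v| <= eps.
Proof.
move=> flip Bv eps eps0; apply: contrapT => H.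
have [K [d d0 fK]] := locally_lipschitz_ball _ _ x flip.
have /choice[u uP] n : exists y, [/\ ball x (Num.min d n.+1%:R^-1) y,
    derivable f y 1 & eps < `|derive1 f y - v|].
  apply: contrapT => nH; apply: H; apply/nbhs_ballP.
  exists (Num.min d n.+1%:R^-1); first by rewrite /= lt_min d0 invr_gt0 ltr0Sn.
  move=> y xy dy; rewrite leNgt; apply/negP => ydy; apply: nH; exists y.
  by split.
have uK n : derive1 f (u n) \in `[- K, K].
  have [+ dun _] := uP n; rewrite in_itv/= -ler_norml => xun.
  have {}xun : ball x d (u n).
    by apply: le_ball xun; rewrite ge_min lexx.
  apply: derive1_lipschitz_le dun.
  have : nbhs (u n) (ball x d).
    by apply: open_nbhs_nbhs; split => //; exact: ball_open.
  by apply: filterS => y xy; exact: fK.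
have [l [lK]] : `[- K, K]%classic `&` cluster ((fun n => derive1 f (u n)) @ \oo) !=set0.
  by apply: (@segment_compact R (- K) K); exists 0%N => //= n _; exact: uK.
move=> /cluster_eventually_cvg[s /increasing_seqP s_incr sl].
have ux : u @ \oo --> x.
  apply/cvgrPdist_lt => e e0; near=> n.
  have [+ _ _] := uP n; rewrite /ball/= lt_min => /andP[_ /lt_le_trans]; apply.
  by apply/ltW; near: n; exact: (near_infty_natSinv_lt (PosNum e0)).
have lv : l = v.
  apply: Bv; exists (u \o s); split => //.
  - by move=> k; have [] := uP (s k).
  - apply: cvg_comp ux => A [N _ NA]; exists N => // n /= Nn; apply: NA => /=.
    apply: leq_trans Nn _.
    by elim: n => // n IHn; exact: leq_ltn_trans IHn (s_incr n).
suff : eps <= `|l - v| by rewrite lv subrr normr0 leNgt eps0.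
have slv : `|derive1 f (u (s n)) - v| @[n --> \oo] --> `|l - v|.
  by apply: cvg_norm; apply: cvgB; [exact: sl|exact: cvg_cst].
apply: (cvgr_to_ge slv).
by near=> n; have [_ _ /ltW] := uP (s n).
Unshelve. all: by end_near. Qed.

(** Near [x] every existing derivative is within [eps] of [v]; the slope bound for [f] and for [- f]
    on the segment between the two points gives both sides of the estimate. *)
Lemma clarke_singleton_strict_derivative (R : realType) (f : R -> R) (x v : R) :
  locally_lipschitz f -> clarke_jacobian f x = [set v] ->
  forall eps, 0 < eps -> exists2 d, 0 < d &
    forall y z, ball x d y -> ball x d z ->
      `|f y - f z - v * (y - z)| <= eps * `|y - z|.
Proof.
move=> flip fv eps eps0.
have Bv : B_subdifferential f x `<=` [set v].
  by rewrite -fv; exact: sub_gen_smallest.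
have [K [d1 d10 fK]] := locally_lipschitz_ball _ _ x flip.
have /nbhs_ballP[d2 /= d20 fd] :=
  B_subdifferential_singleton_near _ _ _ _ flip Bv _ eps0.
exists (Num.min d1 d2); first by rewrite lt_min d10.
suff lt_case y z : ball x (Num.min d1 d2) y -> ball x (Num.min d1 d2) z ->
    y < z -> `|f y - f z - v * (y - z)| <= eps * `|y - z|.
  move=> y z xy xz; have [yz|zy|->] := ltgtP y z; first exact: lt_case.
  - have -> : f y - f z - v * (y - z) = - (f z - f y - v * (z - y)) by ring.
    by rewrite normrN (distrC y); exact: lt_case.
  - by rewrite !subrr mulr0 subrr normr0 mulr0.
move=> xy xz yz.
have xw w : y <= w <= z -> ball x d1 w /\ ball x d2 w.
  move: xy xz; rewrite /ball/= !lt_min !ltr_distlC => /andP[xy1 xy2] /andP[xz1 xz2] yw.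
  by split; lra.
have ywz w : y < w < z -> y <= w <= z by move=> /andP[? ?]; rewrite !ltW.
have fK' u w : y <= u <= z -> y <= w <= z -> `|f u - f w| <= K * `|u - w|.
  by move=> /xw[xu _] /xw[xw1 _]; exact: fK.
have := lipschitz_slope_le _ f K (v + eps) y z yz fK'.
have := lipschitz_slope_le _ (- f) K (- v + eps) y z yz.
rewrite !fctE => H1 H2.
have {}H1 : - f z - - f y <= (- v + eps) * (z - y).
  apply: H1 => [u w yu yw|w /[dup] /ywz/xw[_ xw2] yw].
    by rewrite -opprD normrN; exact: fK'.
  move=> /derivableN; rewrite opprK => df.
  have := fd w xw2 df; rewrite ler_norml => /andP[+ _].
  by rewrite !derive1E deriveN//; lra.
have {}H2 : f z - f y <= (v + eps) * (z - y).
  apply: H2 => w /[dup] /ywz/xw[_ xw2] yw df.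
  by have := fd w xw2 df; rewrite ler_norml => /andP[_]; lra.
rewrite (distrC y) (gtr0_norm (_ : 0 < z - y)) ?subr_gt0// ler_norml; lra.
Qed.

(** * Secant iteration near a point of strict differentiability *)

(** Here [u] is the current error, [p] the residual, [q] the slope in use and [v] the true
    derivative: the new error is the slope error times [u], minus the linearization error, all
    divided by [q]. *)
Lemma secant_step_le (R : realFieldType) (q v p u m eta1 eta2 : R) :
  0 < m -> m <= `|q| -> `|q - v| <= eta1 -> `|p - v * u| <= eta2 * `|u| ->
  `|u - q^-1 * p| <= (eta1 + eta2) / m * `|u|.
Proof.
move=> m0 mq qv pvu.
have q0 : q != 0 by rewrite -normr_gt0 (lt_le_trans m0).
have -> : u - q^-1 * p = q^-1 * ((q - v) * u - (p - v * u)) by field.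
rewrite normrM normfV ler_pdivrMl ?normr_gt0//.
apply: le_trans (ler_normB _ _) _; rewrite normrM.
have u0 : 0 <= `|u| by [].
have e0 : 0 <= (eta1 + eta2) * `|u|.
  rewrite mulrDl addr_ge0//; last exact: le_trans _ pvu.
  by rewrite mulr_ge0//; exact: le_trans _ qv.
rewrite (@le_trans _ _ ((eta1 + eta2) * `|u|))//.
  by rewrite mulrDl lerD// ler_wpM2r.
by rewrite mulrAC mulrA ler_pdivlMr// mulrC ler_wpM2r.
Qed.

Section secant_sequence_theory.
Context {R : realType}.
Variables (phi : R -> R) (l v : R).
Hypothesis v_neq0 : v != 0.
Hypothesis strict : forall eps, 0 < eps -> exists2 d, 0 < d &
  forall y z, ball l d y -> ball l d z ->
    `|phi y - phi z - v * (y - z)| <= eps * `|y - z|.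

Lemma strict_divided_difference eps d y z :
  (forall y z, ball l d y -> ball l d z ->
    `|phi y - phi z - v * (y - z)| <= eps * `|y - z|) ->
  ball l d y -> ball l d z -> y != z ->
  `|divided_difference phi y z - v| <= eps.
Proof.
move=> H ly lz yz; have yz0 : y - z != 0 by rewrite subr_eq0.
have -> : divided_difference phi y z - v = (phi y - phi z - v * (y - z)) / (y - z).
  by rewrite /divided_difference; field.
by rewrite normrM normfV ler_pdivrMr ?normr_gt0//; exact: H.
Qed.

(** Indices are shifted by one: [s 0] and [s 1] are the two initial points. *)
Let secant (s : nat -> R) := forall n, s n.+2 =
  s n.+1 - (divided_difference phi (s n.+1) (s n))^-1 * (phi (s n.+1) - phi l).

Lemma secant_local : exists2 d, 0 < d & forall s : nat -> R,
  ball l d (s 0%N) -> ball l d (s 1%N) -> s 0%N != s 1%N -> secant s ->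
  (forall n, s n != l) ->
  forall n, [/\ s n.+1 != s n, ball l d (s n), ball l d (s n.+1),
    `|v| / 2 <= `|divided_difference phi (s n.+1) (s n)| &
    `|s n.+2 - l| <= `|s n.+1 - l| / 2].
Proof.
have v0 : 0 < `|v| by rewrite normr_gt0.
(* With tolerance |v|/8 the slope is at least 7|v|/8 in size, and the step factor is (|v|/8 + |v|/8)
   / (|v|/2) = 1/2. *)
have e0 : 0 < `|v| / 8 by rewrite divr_gt0.
have [d d0 dphi] := strict _ e0; exists d => // s s0 s1 s01 ss sl.
have step n : s n.+1 != s n -> ball l d (s n) -> ball l d (s n.+1) ->
    `|v| / 2 <= `|divided_difference phi (s n.+1) (s n)| /\
    `|s n.+2 - l| <= `|s n.+1 - l| / 2.
  move=> sn bn bn1.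
  have dv := strict_divided_difference _ _ _ _ dphi bn1 bn sn.
  have vq : `|v| / 2 <= `|divided_difference phi (s n.+1) (s n)|.
    have := ler_normB (divided_difference phi (s n.+1) (s n))
      (divided_difference phi (s n.+1) (s n) - v).
    by rewrite subKr; lra.
  split=> //; rewrite ss addrAC.
  have v2 : 0 < `|v| / 2 by rewrite divr_gt0.
  have := secant_step_le _ _ _ _ _ _ _ _ v2 vq dv
    (dphi _ _ bn1 (ballxx _ d0)).
  have -> : (`|v| / 8 + `|v| / 8) / (`|v| / 2) = 2^-1 by field; rewrite gt_eqF.
  by rewrite [2^-1 * _]mulrC.
suff H n : [/\ s n.+1 != s n, ball l d (s n) & ball l d (s n.+1)].
  by move=> n; have [? ? ?] := H n; have [] := step n.
elim: n => [|n [sn bn bn1]]; first by rewrite eq_sym.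
have [_ sh] := step _ sn bn bn1.
have sl0 : 0 < `|s n.+1 - l| by rewrite normr_gt0 subr_eq0.
split=> //.
  (* Equal consecutive iterates would have a halved, hence zero, error, against [s n.+1 != l]. *)
  by apply: contraTneq sh => ->; rewrite -ltNge; lra.
by move: bn1; rewrite /ball/= ![`|l - _|]distrC; lra.
Qed.

Lemma halving_cvg (s : nat -> R) :
  (forall n, `|s n.+2 - l| <= `|s n.+1 - l| / 2) -> s @ \oo --> l.
Proof.
move=> sh; apply/cvgrPdist_le => e e0.
have sn n : `|s n.+1 - l| <= geometric `|s 1%N - l| 2^-1 n.
  elim: n => [|n IH]; first by rewrite /geometric/= expr0 mulr1.
  apply: le_trans (sh n) _; rewrite /geometric/= exprSr mulrA.
  by rewrite ler_pM2r// invr_gt0.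
have /cvgrPdist_le/(_ _ e0)[N _ /= HN] : geometric `|s 1%N - l| 2^-1 @ \oo --> (0 : R).
  by apply: cvg_geometric; rewrite gtr0_norm; lra.
exists N.+1 => // -[//|n] /= Nn; rewrite distrC.
have := HN n Nn; rewrite sub0r normrN; apply: le_trans.
by apply: le_trans (sn n) _; exact: ler_norm.
Qed.

Lemma secant_superlinear (s : nat -> R) : secant s -> s @ \oo --> l ->
  (forall n, s n.+1 != s n) ->
  (forall n, `|v| / 2 <= `|divided_difference phi (s n.+1) (s n)|) ->
  forall eps, 0 < eps ->
    \forall n \near \oo, `|s n.+2 - l| <= eps * `|s n.+1 - l|.
Proof.
move=> ss sl sn sq eps eps0.
have v0 : 0 < `|v| by rewrite normr_gt0.
(* This tolerance gives the step factor (eps |v|/4 + eps |v|/4) / (|v|/2) = eps. *)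
have [d d0 dphi] : exists2 d, 0 < d & _ :=
  strict (eps * `|v| / 4) ltac:(by rewrite divr_gt0// mulr_gt0).
have /cvg_ballP/(_ _ d0)[N _ /= sN] := sl.
exists N => // n /= Nn.
have bn := sN n Nn; have bn1 := sN n.+1 (leqW Nn).
have dv := strict_divided_difference _ _ _ _ dphi bn1 bn (sn n).
have v2 : 0 < `|v| / 2 by rewrite divr_gt0.
have := secant_step_le _ _ _ _ _ _ _ _ v2 (sq n) dv (dphi _ _ bn1 (ballxx _ d0)).
rewrite ss addrAC => /le_trans; apply; rewrite ler_wpM2r//.
by rewrite le_eqVlt; apply/orP; left; apply/eqP; field; rewrite gt_eqF.
Qed.

(** Identifies the first-order term of the order-gamma expansion at [l], so that its remainder can
    be measured against [v]. *)
Lemma dir_derivative_strict h : dir_derivative phi l h = v * h.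
Proof.
apply: cvg_lim => //; apply/cvgrPdist_le => e e0.
(* Adding 1 covers [h = 0]. *)
have h1 : 0 < `|h| + 1 by rewrite ltr_wpDl.
have [d d0 dphi] := strict _ (divr_gt0 e0 h1).
near=> t.
have t0 : 0 < t by near: t; exact: nbhs_right_gt.
have := dphi (l + t * h) l _ (ballxx _ d0).
rewrite (addrAC l) subrr add0r normrM (gtr0_norm t0) => H.
have -> : v * h - dir_quotient phi l h t =
    - (phi (l + t * h) - phi l - v * (t * h)) / t.
  by rewrite /dir_quotient; field; rewrite gt_eqF.
rewrite normrM normrN normfV (gtr0_norm t0) ler_pdivrMr//.
apply: le_trans (H _) _; last first.
  rewrite mulrAC ler_pdivrMr// -mulrA (ler_pM2l e0) (ler_pM2l t0).
  by rewrite lerDl.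
rewrite /ball/= opprD addrA subrr add0r normrN normrM (gtr0_norm t0).
have th : t < d / (`|h| + 1).
  by near: t; apply: nbhs_right_lt; rewrite divr_gt0.
apply: (@le_lt_trans _ _ (t * (`|h| + 1))); first by rewrite ler_pM2l// lerDl.
by rewrite -ltr_pdivlMr.
Unshelve. all: by end_near. Qed.

Lemma secant_order_recursion (gamma : R) (s : nat -> R) : 0 < gamma ->
  order_dir_differentiable gamma phi l ->
  secant s -> s @ \oo --> l -> (forall n, s n.+1 != s n) ->
  (forall n, s n != l) ->
  (forall n, `|v| / 2 <= `|divided_difference phi (s n.+1) (s n)|) ->
  (forall n, `|s n.+2 - l| <= `|s n.+1 - l| / 2) ->
  exists2 C, 0 < C & \forall n \near \oo,
    `|s n.+2 - l| <= C * (`|s n.+1 - l| * `|s n - l| `^ gamma).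
Proof.
move=> g0 [_ [C0 /nbhs_ballP[d /= d0 dC0]]] ss sl sn snl sq sh.
have v0 : 0 < `|v| by rewrite normr_gt0.
pose C := `|C0| + 1.
have C_gt0 : 0 < C by rewrite ltr_wpDl.
have rC y : y != l -> ball l d y ->
    `|phi y - phi l - v * (y - l)| <= C * `|y - l| `^ gamma * `|y - l|.
  move=> yl; rewrite /ball/= distrC => bly.
  have := dC0 (y - l); rewrite /ball/= sub0r normrN => /(_ bly).
  rewrite dir_derivative_strict [l + _]addrC subrK => /le_trans; apply.
  have yl0 : `|y - l| != 0 by rewrite normr_eq0 subr_eq0.
  rewrite powRD ?yl0 ?implybT// powRr1// mulrCA mulrC.
  by rewrite !ler_wpM2r ?powR_ge0// /C (le_trans (ler_norm _))// lerDl.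
(* With P = |b - l|^gamma, the slope error is at most 3 C P and the relative residual error at most
   C P; dividing 4 C P by |v|/2 gives the 8. *)
exists (8 * C / `|v|); first by rewrite divr_gt0// mulr_gt0.
have /cvg_ballP/(_ _ d0)[N _ /= sN] := sl.
(* Halving holds only from [s 1] on, so the index starts one later. *)
exists N.+1 => // -[//|n] /= Nn; rewrite ltnS in Nn.
have {}bn := sN n.+1 (leqW Nn); have bn1 := sN n.+2 (leqW (leqW Nn)).
have ra := rC _ (snl _) bn1; have rb := rC _ (snl _) bn.
set a := s n.+2 in bn1 ra *; set b := s n.+1 in bn rb *.
have ab : `|a - l| <= `|b - l| / 2 by exact: sh.
have b0 : 0 < `|b - l| by rewrite normr_gt0 subr_eq0; exact: snl.
have a0 : 0 < `|a - l| by rewrite normr_gt0 subr_eq0; exact: snl.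
(* Since the error is halved, |a - b| is comparable to |b - l|, so the expansion
   of phi at l alone controls the divided difference between a and b. *)
have amb : `|b - l| / 2 <= `|a - b|.
  have := ler_normB (b - l) (b - a); have -> : b - l - (b - a) = a - l by ring.
  have := ler_normB (a - l) (a - b); have -> : a - l - (a - b) = b - l by ring.
  by lra.
have abg : `|a - l| `^ gamma <= `|b - l| `^ gamma.
  by apply: ge0_ler_powR; rewrite ?nnegrE//; lra.
set P := `|b - l| `^ gamma in rb abg *.
have P0 : 0 <= P by rewrite powR_ge0.
have {}ra : `|phi a - phi l - v * (a - l)| <= C * P * `|a - l|.
  by apply: le_trans ra _; rewrite ler_wpM2r// ler_wpM2l// ltW.
have CP0 : 0 <= C * P by rewrite mulr_ge0// ltW.
(* The expansions at [a] and [b] have total error at most C P (|a - l| + |b - l|), where |a - l| <=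
   |a - b| and |b - l| <= 2 |a - b|. *)
have qv : `|divided_difference phi a b - v| <= 3 * (C * P).
  have ab0 : a - b != 0 by rewrite subr_eq0; exact: sn.
  have -> : divided_difference phi a b - v =
     ((phi a - phi l - v * (a - l)) - (phi b - phi l - v * (b - l))) / (a - b).
    by rewrite /divided_difference; field.
  rewrite normrM normfV ler_pdivrMr ?normr_gt0//.
  apply: le_trans (ler_normB _ _) _.
  have : C * P * `|a - l| <= C * P * (`|b - l| / 2) by rewrite ler_wpM2l.
  have : C * P * (`|b - l| / 2) <= C * P * `|a - b| by rewrite ler_wpM2l.
  by lra.
have v2 : 0 < `|v| / 2 by rewrite divr_gt0.
have := secant_step_le _ _ _ _ _ _ _ _ v2 (sq n.+1) qv ra.
have -> : s n.+3 - l = a - l - (divided_difference phi a b)^-1 * (phi a - phi l).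
  by rewrite ss addrAC.
move=> /le_trans; apply; rewrite -/a -/b -/P.
by rewrite le_eqVlt; apply/orP; left; apply/eqP; field; rewrite gt_eqF.
Qed.

End secant_sequence_theory.

(** * Limits superior and growth of scalar recursions *)

Lemma limn_esup_le (R : realType) (u : (\bar R)^nat) (l : \bar R) :
  (\forall n \near \oo, (u n <= l)%E) -> (limn_esup u <= l)%E.
Proof.
move=> ul; rewrite /limn_esup /limf_esup.
apply: (@le_trans _ _ (ereal_sup (u @` [set n | (u n <= l)%E]))).
  by apply: ereal_inf_lbound; exists [set n | (u n <= l)%E].
by apply: ub_ereal_sup => _ [n /= unl <-].
Qed.

(** The shift by c / gamma absorbs the constant: b_{n+2} >= b_{n+1} + gamma b_n. As t^n solves this
    with equality, a comparison at two consecutive indices propagates. *)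
Lemma exponential_lower_bound (R : realType) (a : nat -> R) (gamma c t : R) :
  0 <= c -> 0 < gamma -> 1 < t -> t ^+ 2 = t + gamma ->
  a @ \oo --> +oo ->
  (\forall n \near \oo, a n.+1 + gamma * a n - c <= a n.+2) ->
  exists2 m, 0 < m & \forall n \near \oo, m * t ^+ n <= a n.
Proof.
move=> c0 g0 t1 tg aoo arec.
have t0 : 0 < t by lra.
pose b n := a n - c / gamma.
have [N _ /= bN] : \forall n \near \oo,
    1 <= b n /\ b n.+1 + gamma * b n <= b n.+2.
  near=> n; split.
    rewrite /b lerBrDr; near: n.
    by move: aoo => /cvgryPge; apply.
  have : a n.+1 + gamma * a n - c <= a n.+2 by near: n.
  have -> : b n.+1 + gamma * b n = a n.+1 + gamma * a n - c - c / gamma.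
    by rewrite /b; field; rewrite gt_eqF.
  by rewrite /b; lra.
(* Division by [t] makes the starting values 1/t and 1, both at most 1 and hence below [b]. *)
have bt i : t ^+ i / t <= b (i + N)%N /\ t ^+ i.+1 / t <= b (i.+1 + N)%N.
  elim: i => [|i [IH1 IH2]].
    rewrite expr0 mul1r expr1 divff ?gt_eqF//; split.
      by apply: le_trans (proj1 (bN _ _)) => //=; rewrite invf_le1// ltW.
    by apply: (proj1 (bN _ _)); exact: leq_addl.
  split=> //; apply: le_trans (proj2 (bN (i + N)%N (leq_addl _ _))).
  have -> : t ^+ i.+2 / t = t ^+ i.+1 / t + gamma * (t ^+ i / t).
    by rewrite -[i.+2]addn2 exprD tg exprS; field; rewrite gt_eqF.
  by rewrite lerD// ler_pM2l.
exists (t ^- N.+1); first by rewrite invr_gt0 exprn_gt0.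
exists N => // n /= Nn; have [+ _] := bt (n - N)%N.
rewrite subnK//; have : 0 <= c / gamma by rewrite divr_ge0// ltW.
have -> : t ^- N.+1 * t ^+ n = t ^+ (n - N) / t.
  by rewrite -{1}(subnK Nn) exprD exprS; field; rewrite !gt_eqF// exprn_gt0.
by rewrite /b; lra.
Unshelve. all: by end_near. Qed.

Lemma sqr_nat_geometric (R : realType) (rho : R) : 1 < rho ->
  exists2 B, 0 < B & forall n, n%:R ^+ 2 <= B * rho ^+ n.
Proof.
move=> rho1; have l0 := ln_gt0 rho1; have rho0 : 0 < rho by lra.
(* The constant comes from squaring x <= e^x at x = n ln rho / 2. *)
exists (4 / ln rho ^+ 2) => [|n]; first by rewrite divr_gt0// exprn_gt0.
rewrite mulrAC ler_pdivlMr ?exprn_gt0//.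
have -> : rho ^+ n = expR (ln rho * n%:R / 2) ^+ 2.
  by rewrite -expRM_natr divfK// mulrC expRM_natl lnK// posrE.
have h0 : 0 <= ln rho * n%:R / 2 by rewrite divr_ge0// mulr_ge0// ltW.
have : (ln rho * n%:R / 2) ^+ 2 <= expR (ln rho * n%:R / 2) ^+ 2.
  rewrite lerXn2r ?nnegrE ?expR_ge0//.
  by have := expR_ge1Dx (ln rho * n%:R / 2); lra.
by nra.
Qed.

Lemma perturbed_geometric_bound (R : realType) (r : nat -> R) (lam rho B : R) :
  0 <= lam -> lam < rho -> 0 <= B ->
  (\forall n \near \oo, `|r n.+1| <= lam * `|r n| + B * rho ^+ n) ->
  exists2 A, 0 < A & \forall n \near \oo, `|r n| <= A * rho ^+ n.
Proof.
move=> lam0 lr B0 [N _ /= rN].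
have rho0 : 0 < rho by lra.
(* The first term gives A (rho - lam) >= B, so A rho^n is a supersolution; the second covers the
   starting index [N]; the 1 makes [A] positive. *)
pose A := B / (rho - lam) + `|r N| / rho ^+ N + 1.
have [A1 A2] : 0 <= B / (rho - lam) /\ 0 <= `|r N| / rho ^+ N.
  by split; rewrite divr_ge0// ?exprn_ge0//; lra.
exists A; first by rewrite /A; lra.
exists N => // n /= /subnK <-; elim: (n - N)%N => {n}[|i IH].
  by rewrite -ler_pdivrMr ?exprn_gt0// /A add0n; lra.
apply: le_trans (rN (i + N)%N (leq_addl _ _)) _.
have rp : 0 < rho ^+ (i + N) by rewrite exprn_gt0.
have AB : B <= A * (rho - lam).
  rewrite -ler_pdivrMr ?subr_gt0// /A; lra.
rewrite addSn exprS.
have : lam * `|r (i + N)%N| <= lam * (A * rho ^+ (i + N)) by rewrite ler_wpM2l.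
have : B * rho ^+ (i + N) <= A * (rho - lam) * rho ^+ (i + N) by rewrite ler_pM2r.
by lra.
Qed.

(** The order is a root of X^2 = X + gamma, the characteristic equation of the recursion for - ln
    |e_n|. *)
Lemma secant_order_root (R : rcfType) (gamma : R) : 0 < gamma ->
  let t := (1 + Num.sqrt (1 + 4 * gamma)) / 2 in
  1 < t /\ t ^+ 2 = t + gamma.
Proof.
move=> g0 t; have q0 : 0 < 1 + 4 * gamma by lra.
have sq := sqr_sqrtr (ltW q0); rewrite /t; set q := Num.sqrt _ in sq *.
have q1 : 1 < q.
  by rewrite /q -[ltLHS](sqrtr1 R) ltr_sqrt// ltrDl mulr_gt0.
split; first by lra.
have -> : ((1 + q) / 2) ^+ 2 = (1 + 2 * q + q ^+ 2) / 4 by field.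
by rewrite sq; field.
Qed.

(** * R-order and Q-order of a sequence obeying the error recursion *)

Section superlinear_order.
Context {R : realType}.
Variables (gamma t C : R) (y : nat -> R).
Hypotheses (gamma_gt0 : 0 < gamma) (t_gt1 : 1 < t) (t_root : t ^+ 2 = t + gamma).
Hypotheses (y_gt0 : forall n, 0 < y n) (y_cvg0 : y @ \oo --> 0).
Hypotheses (C_gt0 : 0 < C) (y_rec : \forall n \near \oo,
  y n.+2 <= C * (y n.+1 * y n `^ gamma)).

Let yg_gt0 n : 0 < y n.+1 * y n `^ gamma.
Proof. by rewrite mulr_gt0// powR_gt0. Qed.

Let ln_yg n : ln (y n.+1 * y n `^ gamma) = ln (y n.+1) + gamma * ln (y n).
Proof. by rewrite lnM ?posrE ?powR_gt0// ln_powR. Qed.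

(** Logarithms make the recursion linear; [C + 1] replaces [C] so that the constant [ln (C + 1)] is
    nonnegative. *)
Lemma ln_rec_lower : \forall n \near \oo,
  - ln (y n.+1) + gamma * - ln (y n) - ln (C + 1) <= - ln (y n.+2).
Proof.
have C1 : 0 < C + 1 by rewrite addr_gt0.
apply: filterS y_rec => n yn.
have : ln (y n.+2) <= ln ((C + 1) * (y n.+1 * y n `^ gamma)).
  rewrite ler_ln ?posrE ?mulr_gt0 ?powR_gt0//.
  by apply: le_trans yn _; rewrite ler_pM2r// lerDl.
rewrite [ln (_ * (_ * _))]lnM ?posrE//.
by rewrite ln_yg; lra.
Qed.

Lemma ln_exponential_growth :
  exists2 m, 0 < m & \forall n \near \oo, m * t ^+ n <= - ln (y n).
Proof.
apply: (exponential_lower_bound _ _ gamma (ln (C + 1))) ln_rec_lower => //.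
  by rewrite ln_ge0// lerDr ltW.
apply/cvgryPge => A.
have /cvgrPdist_le/(_ _ (expR_gt0 (- A))) := y_cvg0.
apply: filterS => n; rewrite sub0r normrN gtr0_norm// => yA.
by rewrite lerNr -[leRHS]expRK ler_ln ?posrE ?expR_gt0.
Qed.

Lemma r_order_of_recursion s : 1 < s -> s < t ->
  (limn_esup (fun k => (y k `^ (1 / s ^+ k))%:E) < 1)%E.
Proof.
move=> s1 st; have s0 : 0 < s by lra.
have [m m0 ym] := ln_exponential_growth.
(* With u = - ln y, the k-th term is exp(- u_k / s^k), and u_k >= m t^k >= m s^k. *)
apply: (@le_lt_trans _ _ (expR (- m))%:E); last first.
  by rewrite lte_fin -[ltRHS]expR0 ltr_expR; lra.
apply: limn_esup_le; apply: filterS ym => n yn.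
rewrite lee_fin /powR gt_eqF// ler_expR div1r lerNr -mulrN.
have sn : 0 < s ^+ n by rewrite exprn_gt0.
rewrite ler_pdivlMl// mulrC; apply: le_trans yn; rewrite ler_pM2l//.
by rewrite lerXn2r ?nnegrE; lra.
Qed.

Lemma q_order_of_recursion C' : 0 < C' ->
  (\forall n \near \oo,
    C' * n.+2%:R ^- n.+2 <= y n.+2 / (y n.+1 * y n `^ gamma)) ->
  forall s, 1 <= s -> s < t ->
    (limn_esup (fun k => (y k.+1 / y k `^ s)%:E) < +oo)%E.
Proof.
move=> C'0 yC' s s1 st; have t0 : 0 < t by lra.
have [m m0 ym] := ln_exponential_growth.
(* As t and 1 - t are the roots of X^2 - X - gamma, r satisfies a first-order
   recursion of ratio 1 - t, perturbed by O(n^2). *)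
pose r n := - ln (y n.+1) + t * ln (y n).
(* A ratio above 1 dominates n^2, above t - 1 dominates the homogeneous recursion for [r], and below
   t is negligible against u_n. *)
pose rho := (t + Num.max 1 (t - 1)) / 2.
have [rho1 rhot1 rhot] : [/\ 1 < rho, t - 1 < rho & rho < t].
  by rewrite /rho /Num.max; case: ifPn; rewrite -?leNgt; split; lra.
clearbody rho; have rho0 : 0 < rho by lra.
have rt0 : 0 < rho / t by rewrite divr_gt0.
have [B B0 nB] := sqr_nat_geometric _ _ rho1.
pose D := B * rho ^+ 2 + `|ln C'| + ln (C + 1).
have lnC1 : 0 <= ln (C + 1) by rewrite ln_ge0// lerDr ltW.
have D0 : 0 <= D by rewrite !addr_ge0// mulr_ge0 ?exprn_ge0// ltW.
have r_rec : \forall n \near \oo, `|r n.+1| <= (t - 1) * `|r n| + D * rho ^+ n.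
  near=> n.
  have lower : - ln (y n.+1) + gamma * - ln (y n) - ln (C + 1) <= - ln (y n.+2).
    by near: n; exact: ln_rec_lower.
  have upper : - ln (y n.+2) <=
      - ln (y n.+1) + gamma * - ln (y n) + n.+2%:R ^+ 2 - ln C'.
    have : C' * n.+2%:R ^- n.+2 <= y n.+2 / (y n.+1 * y n `^ gamma) by near: n.
    have nn0 : 0 < (n.+2%:R : R) ^- n.+2 by rewrite invr_gt0 exprn_gt0.
    rewrite ler_pdivlMr// -ler_ln ?posrE//; last by rewrite !mulr_gt0// powR_gt0.
    rewrite [ln (C' * _ * _)]lnM ?posrE ?yg_gt0 ?mulr_gt0// ln_yg lnM ?posrE//.
    rewrite lnV ?posrE ?exprn_gt0// lnXn// -[ln _ *+ _]mulr_natr.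
    (* The weight n^-n costs only n ln n <= n^2 after taking logarithms. *)
    have : ln n.+2%:R * n.+2%:R <= (n.+2%:R : R) ^+ 2.
      rewrite expr2 ler_pM2r//.
      by apply/ltW/ln_sublinear.
    by lra.
  have rE : r n.+1 = - (t - 1) * r n +
      (- ln (y n.+2) - (- ln (y n.+1) + gamma * - ln (y n))).
    have -> : gamma = t ^+ 2 - t by rewrite t_root; ring.
    by rewrite /r; ring.
  have rhon : 1 <= rho ^+ n by rewrite exprn_ege1// ltW.
  have := nB n.+2; rewrite -addn2 exprD addn2 mulrCA => nBn.
  have C'n : `|ln C'| <= `|ln C'| * rho ^+ n by rewrite ler_peMr.
  have Cn : ln (C + 1) <= ln (C + 1) * rho ^+ n by rewrite ler_peMr.
  have := ler_norm (- ln C'); rewrite normrN => lC'; have lC'0 := normr_ge0 (ln C').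
  rewrite rE; apply: le_trans (ler_normD _ _) _.
  rewrite normrM normrN (ger0_norm (_ : 0 <= t - 1)); last by lra.
  rewrite lerD2l ler_norml; apply/andP; split.
    have : 0 <= B * rho ^+ 2 * rho ^+ n.
      by rewrite (mulr_ge0 (mulr_ge0 (ltW B0) _))// exprn_ge0// ltW.
    by rewrite /D; lra.
  have : 0 <= ln (C + 1) * rho ^+ n by lra.
  by rewrite /D; lra.
have [A A0 rA] := perturbed_geometric_bound _ r (t - 1) rho D
  ltac:(lra) rhot1 D0 r_rec.
have small : \forall n \near \oo, A * rho ^+ n <= (t - s) * m * t ^+ n.
  have tsm : 0 < (t - s) * m / A by rewrite divr_gt0// mulr_gt0// subr_gt0.
  have : (fun n => (rho / t) ^+ n) @ \oo --> (0 : R).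
    apply: cvg_expr; rewrite gtr0_norm//.
    by rewrite ltr_pdivrMr// mul1r.
  move=> /cvgrPdist_le/(_ _ tsm); apply: filterS => n.
  rewrite sub0r normrN ger0_norm ?exprn_ge0 ?(ltW rt0)//.
  by rewrite expr_div_n ler_pdivrMr ?exprn_gt0// mulrAC ler_pdivlMr// mulrC.
(* The ratio is eventually at most 1: with u = - ln y, |r_n| <= (t - s) u_n gives u_{n+1} >= s
   u_n. *)
apply: (@le_lt_trans _ _ 1%E); last exact: ltry.
apply: limn_esup_le; near=> n.
rewrite lee_fin ler_pdivrMr ?powR_gt0// mul1r -ler_ln ?posrE ?powR_gt0//.
rewrite ln_powR.
have : m * t ^+ n <= - ln (y n) by near: n.
rewrite -(ler_pM2l (_ : 0 < t - s)) ?subr_gt0// => H1.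
have H2 : A * rho ^+ n <= (t - s) * m * t ^+ n by near: n.
have : `|r n| <= A * rho ^+ n by near: n.
by rewrite ler_norml /r => /andP[+ _]; lra.
Unshelve. all: by end_near. Qed.

End superlinear_order.

(** * Convergence and orders of the secant sequence *)

Theorem proposition9 (R : realType) (phi : R -> R) (rho lstar vstar : R)
    (phi_lip : locally_lipschitz phi)
    (lstar_sol : phi lstar = rho)
    (clarke_vstar : clarke_jacobian phi lstar = [set vstar])
    (vstar_neq0 : vstar != 0) :
  exists2 U : set R, nbhs lstar U &
    forall lam : int -> R,
      U (lam (-1)) -> U (lam 0) -> lam (-1) != lam 0 ->
      secant_sequence phi rho lam ->
      let e := fun k : int => lam k - lstar in
      (forall k : int, -1 <= k -> 0 < `|e k|) ->
      (semismooth phi lstar ->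
         q_superlinear (fun k : nat => lam k%:Z) lstar)
      /\
      (forall gamma : R, 0 < gamma -> order_semismooth gamma phi lstar ->
         let c := fun k : int =>
           `|e k| / (`|e (k - 1)| * `|e (k - 2)| `^ gamma) in
         let t := (1 + Num.sqrt (1 + 4 * gamma)) / 2 in
         (q_superlinear (fun k : nat => lam k%:Z) lstar /\
          q_order_at_least t (fun k : nat => lam k%:Z) lstar)
         \/
         ((q_superlinear (fun k : nat => lam k%:Z) lstar /\
           r_order_at_least t (fun k : nat => lam k%:Z) lstar) /\
          forall C : R, 0 < C ->
            exists i : nat -> nat,
              [/\ forall k, (1 <= i k)%N,
                  {homo i : m n / (m < n)%N} &
                  forall k, c (i k)%:Z < C * (i k)%:R ^- i k])).
Proof.
have strict := clarke_singleton_strict_derivative _ _ _ _ phi_lip clarke_vstar.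
have [d d0 local] := secant_local _ _ _ vstar_neq0 strict.
exists (ball lstar d); first exact: nbhsx_ballx.
move=> lam Um1 U0 lam01 lam_sec e e_gt0.
pose s (n : nat) := lam (n%:Z - 1).
have sS n : s n.+1 = lam n%:Z by rewrite /s -addn1 PoszD addrK.
have s_sec n : s n.+2 = s n.+1 -
    (divided_difference phi (s n.+1) (s n))^-1 * (phi (s n.+1) - phi lstar).
  by rewrite !sS lstar_sol -addn1 PoszD; exact: lam_sec.
have s_neq n : s n != lstar.
  by rewrite -subr_eq0 -normr_gt0; apply: e_gt0; rewrite lerBrDr subrr.
have s01 : s 0%N != s 1%N by rewrite sS.
have s1 : ball lstar d (s 1%N) by rewrite sS.
have H := local s Um1 s1 s01 s_sec s_neq.
have sn n : s n.+1 != s n by have [] := H n.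
have sq n : `|vstar| / 2 <= `|divided_difference phi (s n.+1) (s n)|.
  by have [] := H n.
have sh n : `|s n.+2 - lstar| <= `|s n.+1 - lstar| / 2 by have [] := H n.
have scvg := halving_cvg _ _ sh.
have lamE : (fun k : nat => lam k%:Z) = (fun k => s k.+1).
  by apply/funext => k; rewrite sS.
(* Proved once, for (i) and for both alternatives of (ii). *)
have qs : q_superlinear (fun k : nat => lam k%:Z) lstar.
  rewrite lamE; split; first by rewrite (@cvg_shiftS _ s).
  apply/eqoP => eps eps0.
  have := secant_superlinear _ _ _ vstar_neq0 strict s s_sec scvg sn sq eps eps0.
  by apply: filterS => n; rewrite !normr_id.
split=> // gamma gamma0 [_ odd] c t.
have [t1 t2] := secant_order_root _ _ gamma0; rewrite -/t in t1 t2.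
have [C C0 [N _ /= recN]] := secant_order_recursion _ _ _ vstar_neq0 strict _ _
  gamma0 odd s_sec scvg sn s_neq sq sh.
pose y n := `|lam n%:Z - lstar|.
have y_gt0 n : 0 < y n by apply: e_gt0.
have y_cvg0 : y @ \oo --> 0.
  have := cvg_norm (cvgB qs.1 (cvg_cst lstar)); rewrite subrr normr0; exact.
have y_rec : \forall n \near \oo, y n.+2 <= C * (y n.+1 * y n `^ gamma).
  by exists N => // n /= Nn; rewrite /y -!sS; exact: recN (leqW Nn).
have cE n : c n.+2%:Z = y n.+2 / (y n.+1 * y n `^ gamma).
  have -> : c n.+2%:Z = y n.+2 /
    (`|lam (n.+2%:Z - 1) - lstar| * `|lam (n.+2%:Z - 2) - lstar| `^ gamma) by [].
  have -> : n.+2%:Z - 1 = n.+1%:Z by rewrite (intS n.+1) addrAC subrr add0r.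
  by rewrite -[in n.+2%:Z - 2]addn2 PoszD addrK.
(* Excluded middle: either some constant eventually bounds c_n n^n from below, or every constant
   fails at arbitrarily large n. The shift by 2 keeps all indices natural. *)
have [[C' [C'0 cC']]|cC'] := pselect (exists C', 0 < C' /\ \forall n \near \oo,
    C' * n.+2%:R ^- n.+2 <= y n.+2 / (y n.+1 * y n `^ gamma)).
  left; split=> // u u1 ut.
  exact: (q_order_of_recursion _ _ _ _ gamma0 t1 t2 y_gt0 y_cvg0 C0 y_rec C').
right; split; first split=> // u u1 ut.
  exact: (r_order_of_recursion _ _ _ _ gamma0 t1 t2 y_gt0 y_cvg0 C0 y_rec).
move=> K K0.
have /choice[f fP] M : exists n, (M < n)%N /\
    (1 <= n)%N /\ c n%:Z < K * n%:R ^- n.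
  apply: contrapT => nH; apply: cC'; exists K; split=> //.
  exists M => // n /= Mn; rewrite leNgt; apply/negP => cn; apply: nH.
  by exists n.+2; rewrite cE; split; first exact: leqW.
(* Since [f M > M], iterating [f] is strictly increasing; [k.+1] makes every term a value of [f]. *)
exists (fun k => iter k.+1 f 0%N); split.
- by move=> k; rewrite iterS; have [_ []] := fP (iter k f 0%N).
- by apply: homo_ltn => [x z w|k]; [exact: ltn_trans|have [] := fP (iter k.+1 f 0%N)].
- by move=> k; rewrite iterS; have [_ []] := fP (iter k f 0%N).
Qed.
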